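(* The function $$\|\psi\|_\pm:=\inf\{\lambda\ge0\ :\ \psi\in\lambda\,\mathcal C_1\}$$ is a norm on the space of all tensors $\psi\in\mathbb R^{r_1\times\cdots\times r_p}$.
   Context: Fix an order $p\ge1$ and dimensions $r_1,\dots,r_p\ge1$; $[s]=\{1,\dots,s\}$ and $\mathcal R=[r_1]\times\cdots\times[r_p]$. For a tensor $\psi\in\mathbb R^{r_1\times\cdots\times r_p}$ and $x=(x_1,\dots,x_p)\in\mathcal R$, $\psi_x$ denotes the entry with indices $x$. Define $$\mathcal S_1=\Big\{\psi:\ \exists\,\theta^{(k)}\in\{-1,1\}^{r_k}\ (k\in[p])\text{ with }\psi_x=\prod_{k=1}^p\theta^{(k)}_{x_k}\ \forall x\in\mathcal R\Big\},\qquad \mathcal C_1=\mathrm{conv}(\mathcal S_1).$$ *)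

(* Defs.v *)
From mathcomp Require Import all_boot all_order all_algebra.
From mathcomp Require Import all_classical all_reals all_analysis.

Set Implicit Arguments.
Unset Strict Implicit.
Unset Printing Implicit Defensive.

Import Order.TTheory GRing.Theory Num.Theory.
Local Open Scope classical_set_scope.
Local Open Scope ring_scope.

Definition conv_hull (R : realType) (V : lmodType R) (A : set V) : set V :=
  smallest (@convex_set R V) A.

Definition is_norm (R : realType) (V : lmodType R) (N : V -> R) : Prop :=
  [/\ forall v, 0 <= N v,
      forall v, N v = 0 <-> v = 0,
      forall (a : R) v, N (a *: v) = `|a| * N v
    & forall u v, N (u + v) <= N u + N v].

(* Multi-indices (x_1, ..., x_p) with x_k in {0, ..., r k - 1}: a dependent
   finite product, since the dimensions may differ from mode to mode. *)
Definition multi_index (p : nat) (r : 'I_p -> nat) : finType :=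
  {dffun forall k : 'I_p, 'I_(r k)}.

Definition tensor (R : realType) (p : nat) (r : 'I_p -> nat) : lmodType R :=
  {ffun multi_index r -> R}.

Definition sign_tensors (R : realType) (p : nat) (r : 'I_p -> nat) :
    set (tensor R r) :=
  [set psi : {ffun multi_index r -> R} |
    exists theta : forall k : 'I_p, 'I_(r k) -> R,
      (forall k i, theta k i = -1 \/ theta k i = 1) /\
      (forall x : multi_index r, psi x = \prod_(k < p) theta k (x k))].

Definition sign_polytope (R : realType) (p : nat) (r : 'I_p -> nat) :
    set (tensor R r) :=
  conv_hull (@sign_tensors R p r).

Definition dilation_factors (R : realType) (p : nat) (r : 'I_p -> nat)
    (psi : tensor R r) : set R :=
  [set lambda : R | 0 <= lambda /\
    [set lambda *: phi | phi in @sign_polytope R p r] psi].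

(* [inf] is real-valued, with value 0 by convention on the empty set, so it is
   the infimum only when [has_inf (dilation_factors psi)]. *)
Definition pm_norm (R : realType) (p : nat) (r : 'I_p -> nat)
    (psi : tensor R r) : R :=
  inf (dilation_factors psi).

(* Main.v *)
(* [pm_norm] is the Minkowski gauge of the sign polytope, and the gauge of a
   convex symmetric absorbing set that contains no line is a norm. The polytope
   is symmetric because flipping the first factor negates a sign tensor, it is
   bounded because its entries lie in [-1, 1], and it is absorbing because the
   sign tensors span the whole space. *)
Require Import Defs.
From mathcomp Require Import all_boot all_order all_algebra.
From mathcomp Require Import all_classical all_reals all_analysis.

Set Implicit Arguments.
Unset Strict Implicit.
Unset Printing Implicit Defensive.

Import Order.TTheory GRing.Theory Num.Theory.
Local Open Scope classical_set_scope.
Local Open Scope ring_scope.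

(** The analogue of [dilation_factors] for any set in any module; [dilation_factors psi] is, by
    unfolding, the instance at [sign_polytope]. *)
Definition dilations (R : realType) (V : lmodType R) (C : set V) (v : V) : set R :=
  [set lambda : R | 0 <= lambda /\ [set lambda *: phi | phi in C] v].

(** Trades the bundled interval weight and boolean membership of [convex_set] for a real weight with
    explicit bounds. *)
Lemma convex_setP (R : realType) (V : lmodType R) (C : set V) :
  @convex_set R V C <->
  forall u v t, 0 <= t -> t <= 1 -> C u -> C v -> C (t *: u + (1 - t) *: v).
Proof.
split=> [Ccvx u v t t0 t1 Cu Cv|Ccvx u v t uC vC].
  have := Ccvx u v (Itv01 t0 t1); rewrite !inE => /(_ Cu Cv).
  by [].
rewrite inE; apply: Ccvx; by [| |exact: set_mem].
Qed.

Lemma conv_hull_convex (R : realType) (V : lmodType R) (A : set V) :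
  @convex_set R V (conv_hull A).
Proof.
apply/convex_setP => u v t t0 t1 hu hv B [Bcvx AB].
by move/convex_setP: (Bcvx); apply=> //; [apply: hu|apply: hv].
Qed.

(** The vectors whose opposite lies in the hull form a convex set containing [A], so minimality of
    the hull applies. *)
Lemma conv_hull_opp (R : realType) (V : lmodType R) (A : set V) :
  (forall v, A v -> A (- v)) -> forall v, conv_hull A v -> conv_hull A (- v).
Proof.
move=> AN; apply: (@smallest_sub _ _ _ [set v | conv_hull A (- v)]); last first.
  by move=> v /AN Av; exact: sub_gen_smallest.
apply/convex_setP => u v t t0 t1 hu hv /=.
rewrite opprD -!scalerN.
exact: (convex_setP _).1 (@conv_hull_convex _ _ _) _ _ _ t0 t1 hu hv.
Qed.

(** [l *: phi + m *: chi] is [l + m] times the convex combination with weights [l / (l + m)] and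
    [m / (l + m)]. *)
Lemma dilationsD (R : realType) (V : lmodType R) (C : set V) (u v : V) (l m : R) :
  @convex_set R V C ->
  dilations C u l -> dilations C v m -> dilations C (u + v) (l + m).
Proof.
move=> /convex_setP Ccvx [l0 [phi Cphi <-]] [m0 [chi Cchi <-]].
split; first exact: addr_ge0.
(* A zero total forces [l = m = 0], and any point of [C] is then a witness. *)
have [lm0|lm0] := eqVneq (l + m) 0.
  move/eqP: lm0; rewrite paddr_eq0// => /andP[/eqP-> /eqP->].
  by exists phi => //; rewrite addr0 !scale0r addr0.
have lm_gt0 : 0 < l + m by rewrite lt_def lm0 addr_ge0.
exists (l / (l + m) *: phi + (1 - l / (l + m)) *: chi).
  by apply: Ccvx; rewrite ?divr_ge0 ?ler_pdivrMr ?mul1r ?lerDl// ltW.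
have -> : 1 - l / (l + m) = m / (l + m).
  by rewrite -(divff lm0) -mulrBl addrAC subrr add0r.
by rewrite scalerDr !scalerA ![(l + m) * _]mulrC !divfK.
Qed.

Lemma dilationsZ (R : realType) (V : lmodType R) (C : set V) (a : R) (v : V) (l : R) :
  (forall u, C u -> C (- u)) ->
  dilations C v l -> dilations C (a *: v) (`|a| * l).
Proof.
move=> CN [l0 [phi Cphi <-]]; split; first by rewrite mulr_ge0.
case: (ger0P a) => _; first by exists phi; rewrite // scalerA.
by exists (- phi); [exact: CN|rewrite scalerN -scaleNr mulNr opprK scalerA].
Qed.

Lemma has_lbound_dilations (R : realType) (V : lmodType R) (C : set V) (v : V) :
  has_lbound (dilations C v).
Proof. by exists 0 => l []. Qed.

(** Absorption keeps each infimum off the default value on the empty set; the last hypothesis yields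
    definiteness. *)
Lemma gauge_is_norm (R : realType) (V : lmodType R) (C : set V) :
  @convex_set R V C ->
  (forall v, C v -> C (- v)) ->
  (forall v, dilations C v !=set0) ->
  (forall v, v <> 0 -> exists2 e, 0 < e & lbound (dilations C v) e) ->
  is_norm (fun v => inf (dilations C v)).
Proof.
move=> Ccvx CN Cabs Cbnd.
have inf_ge v : lbound (dilations C v) (inf (dilations C v)).
  exact/ge_inf/has_lbound_dilations.
have N_ge0 v : 0 <= inf (dilations C v).
  by apply: lb_le_inf => // l [].
have leNZ a v : inf (dilations C (a *: v)) <= `|a| * inf (dilations C v).
  have [->|a0] := eqVneq a 0.
    have [l hl] := Cabs v.
    rewrite normr0 mul0r; apply: inf_ge.
    by have := @dilationsZ _ _ _ 0 _ _ CN hl; rewrite normr0 mul0r.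
  rewrite -ler_pdivrMl ?normr_gt0//; apply: lb_le_inf => // l hl.
  by rewrite ler_pdivrMl ?normr_gt0//; apply/inf_ge/dilationsZ.
have N0 : inf (dilations C 0) = 0.
  by apply/le_anti; rewrite N_ge0 andbT -(scale0r 0) (le_trans (leNZ _ _))//
    normr0 mul0r.
split=> // [v|a v|u v].
- split=> [Nv0|->//]; apply: contrapT => /Cbnd[e e0 lb_e].
  by have := lb_le_inf (Cabs v) lb_e; rewrite Nv0 leNgt e0.
- have [->|a0] := eqVneq a 0; first by rewrite scale0r normr0 mul0r.
  (* The reverse inequality is [leNZ] for [a^-1] and [a *: v]. *)
  apply/le_anti; rewrite leNZ /= -ler_pdivlMl ?normr_gt0// -normfV.
  by rewrite -{1}[v](scalerK a0) leNZ.
- rewrite -lerBlDr; apply: lb_le_inf => // l hl.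
  rewrite lerBlDr [l + _]addrC -lerBlDr; apply: lb_le_inf => // m hm.
  by rewrite lerBlDr [m + _]addrC; apply/inf_ge/dilationsD.
Qed.

Lemma sign_tensors_opp (R : realType) (p : nat) (r : 'I_p -> nat) (psi : tensor R r) :
  (1 <= p)%N -> sign_tensors psi -> sign_tensors (- psi).
Proof.
case: p r psi => // p r psi _ [theta [theta1 psiE]].
exists (fun k i => (if k == ord0 then -1 else 1) * theta k i); split=> [k i|x].
  case: ifP => _; rewrite ?mulN1r ?mul1r//.
  by case: (theta1 k i) => ->; [right|left]; rewrite ?opprK.
rewrite ffunE psiE !big_ord_recl/= !mulN1r mulNr; congr (- (_ * _)).
by apply: eq_bigr => k _; rewrite mul1r.
Qed.

(** The slab [|phi x| <= 1] is convex and contains every sign tensor, hence their hull. *)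
Lemma sign_polytope_bound (R : realType) (p : nat) (r : 'I_p -> nat)
    (psi : {ffun multi_index r -> R}) (x : multi_index r) :
  @sign_polytope R p r psi -> `|psi x| <= 1.
Proof.
apply: (@smallest_sub _ _ _ [set phi : {ffun multi_index r -> R} | `|phi x| <= 1]).
  apply/convex_setP => u v t t0 t1 /= hu hv.
  rewrite !ffunE (le_trans (ler_normD _ _))// !normrM.
  rewrite (ger0_norm t0) (@ger0_norm _ (1 - t)) ?subr_ge0//.
  by rewrite -[leRHS](subrKC t) lerD// ?ler_piMr// ?subr_ge0.
move=> phi [theta [theta1 phiE]] /=; rewrite phiE normr_prod big1// => k _.
by case: (theta1 k (x k)) => ->; rewrite ?normrN normr1.
Qed.

(* The indicator of [y] is [\prod_k (1 + s_k (x k)) / 2], where [s_k] is the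
   sign vector equal to 1 exactly at [y k]; expanding the product writes it as
   a combination of sign tensors. *)
Lemma delta_sign_tensors (R : realType) (p : nat) (r : 'I_p -> nat) (y : multi_index r) :
  exists2 S : {set 'I_p} -> {ffun multi_index r -> R},
    forall J, @sign_tensors R p r (S J) &
    [ffun x => (x == y)%:R] = 2^-1 ^+ p *: \sum_J S J.
Proof.
pose s k (i : 'I_(r k)) : R := if i == y k then 1 else -1.
exists (fun J : {set 'I_p} =>
  [ffun x : multi_index r => \prod_k (if k \in J then 1 else s k (x k))]).
  move=> J; exists (fun k i => if k \in J then 1 else s k i); split=> [k i|x].
    by rewrite /s; case: ifP => _; [right|case: ifP => _; [right|left]].
  by rewrite ffunE.
apply/ffunP => x; rewrite !ffunE sum_ffunE.
under eq_bigr do rewrite ffunE.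
(* The sum over subsets [J] folds back into the product of the [1 + s k (x k)]; the scalar is then
   split into one factor [2^-1] per mode. *)
rewrite -(bigA_distr _ _ (fun=> 1) (fun k => s k (x k))).
rewrite /GRing.scale/= -[X in _ ^+ X](card_ord p) -prodr_const -big_split/=.
have [->|xy] := eqVneq x y.
  by rewrite big1// => k _; rewrite /s eqxx mulVf.
have [k xyk] : exists k, x k != y k.
  apply/existsP; apply: contraNT xy; rewrite negb_exists => /forallP xy.
  by apply/eqP/ffunP => k; apply/eqP/negPn.
by rewrite (bigD1 k)//= /s (negPf xyk) subrr mulr0 mul0r.
Qed.

(** Tensors with a dilation factor are closed under sums and scalings, and the sign tensors, which
    have factor 1, span the indicators of single entries. *)
Lemma dilation_factors_neq0 (R : realType) (p : nat) (r : 'I_p -> nat)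
    (psi : tensor R r) :
  (1 <= p)%N -> dilation_factors psi !=set0.
Proof.
move=> hp; pose C := @sign_polytope R p r.
have CN v : C v -> C (- v) by apply: conv_hull_opp => u; exact: sign_tensors_opp.
have Ccvx : @convex_set R (tensor R r) C by exact: conv_hull_convex.
have zero_dil : dilations C (0 : tensor R r) 0.
  (* Factor 0 still needs a point of the polytope; the all-ones tensor is one. *)
  split=> //; exists ([ffun=> 1] : {ffun multi_index r -> R}); last by rewrite scale0r.
  apply: sub_gen_smallest; exists (fun _ _ => 1); split=> [*|x]; first by right.
  by rewrite ffunE big1.
have sum_dil (I : finType) (F : I -> tensor R r) :
    (forall i, dilations C (F i) !=set0) -> dilations C (\sum_i F i) !=set0.
  move=> hF; apply: (big_ind (fun v => dilations C v !=set0)) => //.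
    by exists 0.
  by move=> u v [l hl] [m hm]; exists (l + m); apply: dilationsD.
have scale_dil a (v : tensor R r) :
    dilations C v !=set0 -> dilations C (a *: v) !=set0.
  by move=> [l hl]; exists (`|a| * l); apply: dilationsZ.
rewrite -/(dilations C psi).
have -> : psi = \sum_y (psi : {ffun _ -> R}) y *: ([ffun x => (x == y)%:R] : tensor R r).
  apply/ffunP => x; rewrite sum_ffunE (bigD1 x)//= !ffunE eqxx big1 ?addr0 => [|y yx].
    by rewrite /GRing.scale/= mulr1.
  by rewrite !ffunE eq_sym (negPf yx) scaler0.
apply: (sum_dil) => y; apply/scale_dil.
have [S signS ->] := delta_sign_tensors R y.
apply/scale_dil/sum_dil => J; exists 1; split=> //.
by exists (S J); [exact: sub_gen_smallest|rewrite scale1r].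
Qed.

Theorem proposition2 (R : realType) (p : nat) (r : 'I_p -> nat)
    (hp : (1 <= p)%N) (hr : forall k : 'I_p, (1 <= r k)%N) :
  (forall psi : tensor R r, has_inf (dilation_factors psi)) /\
  is_norm (fun psi : tensor R r => pm_norm psi).
Proof.
split=> [psi|].
  by split; [exact: dilation_factors_neq0|exact: has_lbound_dilations].
apply: (@gauge_is_norm R (tensor R r) (@sign_polytope R p r)).
- exact: conv_hull_convex.
- by apply: conv_hull_opp => psi; exact: sign_tensors_opp.
- by move=> psi; exact: dilation_factors_neq0.
move=> psi psi0.
have [x psix0] : exists x, (psi : {ffun _ -> R}) x != 0.
  apply: contrapT => /forallNP psi_eq0; apply: psi0; apply/ffunP => x.
  by rewrite ffunE; apply/eqP/negPn/negP/psi_eq0.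
(* If [psi = l *: phi] with [phi] in the polytope, then [|psi x| = l * |phi x| <= l]. *)
exists `|(psi : {ffun _ -> R}) x|; first by rewrite normr_gt0.
move=> l [l0 [phi Cphi <-]].
by rewrite ffunE normrM (ger0_norm l0) ler_piMr// sign_polytope_bound.
Qed.
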